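(* Let $A_0\in\mathbb{R}^{n\times n}$, $B\in\mathbb{R}^{n\times m}$, and suppose $(A_0,B)$ has a pair of purely imaginary eigenvalues $\pm i\mu$ ($\mu\in\mathbb{R}$, $\mu\neq0$) which are uncontrollable. Let $L\in\mathbb{R}^{n\times2}$ be a matrix whose columns form a basis of the two dimensional $A_0^T$-invariant subspace associated with this complex conjugate pair of uncontrollable eigenvalues of $A_0^T$. Then the equation $$-A_0^TX-XA_0+XBB^TX=0$$ has infinitely many solutions of the form $X=L\mathcal{L}L^T$ with $\mathcal{L}\in\mathbb{R}^{2\times 2}$ symmetric, and the set of solutions is unbounded.
   Context: Solutions $X$ are real symmetric $n\times n$ matrices. The eigenvalue pair $\pm i\mu$ is uncontrollable if there is $v\in\mathbb{C}^n$, $v\neq0$, with $A_0^Tv=i\mu v$ and $B^Tv=0$; the associated two dimensional $A_0^T$-invariant subspace is the real span of the real and imaginary parts of such a $v$ (so $B^TL=0$). Unbounded means unbounded in a norm on $\mathbb{R}^{n\times n}$. *)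

(* Defs.v *)
From mathcomp Require Export all_boot all_order all_algebra.
From mathcomp Require Export all_classical all_reals all_analysis.
From mathcomp Require Export complex.
Export Order.TTheory GRing.Theory Num.Theory numFieldNormedType.Exports.

Set Implicit Arguments.
Unset Strict Implicit.
Unset Printing Implicit Defensive.

Local Open Scope classical_set_scope.
Local Open Scope ring_scope.

(* A real matrix seen as a complex one. *)
Definition complexify (R : realType) (p q : nat) (M : 'M[R]_(p, q)) :
    'M[R[i]]_(p, q) :=
  map_mx (real_complex R) M.

Definition uncontrollable_vector (R : realType) (n m : nat)
    (A0 : 'M[R]_n) (B : 'M[R]_(n, m)) (mu : R) (v : 'cV[R[i]]_n) : Prop :=
  [/\ v != 0,
      complexify A0^T *m v = (0 +i* mu)%C *: v
    & complexify B^T *m v = 0].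

(* The condition is on i mu only: conjugating v gives the one for - i mu. *)
Definition uncontrollable_pair (R : realType) (n m : nat)
    (A0 : 'M[R]_n) (B : 'M[R]_(n, m)) (mu : R) : Prop :=
  exists v : 'cV[R[i]]_n, uncontrollable_vector A0 B mu v.

(* When i mu has geometric multiplicity greater than one, the pair may have
   several associated subspaces, one for each choice of v up to a complex
   factor; hence a predicate on V. *)
Definition associated_subspace (R : realType) (n m : nat)
    (A0 : 'M[R]_n) (B : 'M[R]_(n, m)) (mu : R) (V : {vspace 'cV[R]_n}) : Prop :=
  exists v : 'cV[R[i]]_n,
    uncontrollable_vector A0 B mu v /\
    V = <<[:: map_mx (@complex.Re R) v; map_mx (@complex.Im R) v]>>%VS.

Definition columns_basis (R : realType) (n k : nat)
    (V : {vspace 'cV[R]_n}) (L : 'M[R]_(n, k)) : bool :=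
  basis_of V [seq col j L | j <- enum 'I_k].

Definition symmetric_mx (R : realType) (n : nat) (X : 'M[R]_n) : Prop :=
  X^T = X.

Definition riccati_solutions (R : realType) (n m : nat)
    (A0 : 'M[R]_n) (B : 'M[R]_(n, m)) : set 'M[R]_n :=
  [set X | symmetric_mx X /\
           - A0^T *m X - X *m A0 + X *m B *m B^T *m X = 0].

Definition riccati_solutions_on (R : realType) (n m : nat)
    (A0 : 'M[R]_n) (B : 'M[R]_(n, m)) (L : 'M[R]_(n, 2)) : set 'M[R]_n :=
  [set X | riccati_solutions A0 B X /\
           exists2 S : 'M[R]_2, symmetric_mx S & X = L *m S *m L^T].

(* Main.v *)
(** Write [v = a + i b] for the uncontrollable eigenvector. Then
    [A0^T a = - mu b], [A0^T b = mu a] and [B^T a = B^T b = 0], so that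
    [X0 = a a^T + b b^T] satisfies [A0^T X0 + X0 A0 = 0] and [X0 B = 0]: every
    multiple of the nonzero matrix [X0] solves the equation. Since [a] and [b]
    lie in the column space of [L], [X0] has the form [L S L^T]. *)

Require Import Defs.

Local Open Scope classical_set_scope.
Local Open Scope ring_scope.

Lemma scale_line_unbounded {R : realType} {V : normedModType R} {x : V}
    {A : set V} :
  x != 0 -> (forall t : R, A (t *: x)) -> ~ bounded_set A.
Proof.
move=> x_neq0 Ax; rewrite /bounded_set => -[M [Mreal bndA]].
have nx_gt0 : 0 < `|x| by rewrite normr_gt0.
have lt_MM : M < `|M| + 1 by rewrite (le_lt_trans (ler_norm M))// ltrDl.
(* [bndA] makes every number above [M] a bound; taking [|M| + 1], the multiple of [x] rescaled to
   norm [|M| + 2] breaks it. *)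
have /= := bndA _ lt_MM (((`|M| + 2) / `|x|) *: x) (Ax _).
rewrite normrZ ger0_norm ?divr_ge0 ?addr_ge0// divfK ?gt_eqF//.
by rewrite lerD2l lern1.
Qed.

Lemma finite_bounded {R : realType} {V : normedModType R} {A : set V} :
  finite_set A -> bounded_set A.
Proof. by move/finite_compact/compact_bounded. Qed.

(** The range of [x |-> L *m x] is a subspace containing each column of [L], hence their span
    [V]. *)
Lemma basis_column_combination {R : realType} {n k : nat}
    {V : {vspace 'cV[R]_n}} {L : 'M[R]_(n, k)} {u : 'cV[R]_n} :
  columns_basis V L -> u \in V -> exists x : 'cV[R]_k, u = L *m x.
Proof.
move=> /span_basis <- uV.
have /subvP/(_ _ uV) : (<<[seq col j L | j <- enum 'I_k]>> <=
    limg (linfun (mulmx L : 'cV[R]_k -> 'cV[R]_n)))%VS.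
  apply/span_subvP => _ /mapP[j _ ->].
  by rewrite colE -(lfunE (mulmx L)) memv_img ?memvf.
by case/memv_imgP => x _; rewrite lfunE; exists x.
Qed.

Lemma complexify_mul_parts {R : realType} {p q : nat} (M : 'M[R]_(p, q))
    (v : 'cV[R[i]]_q) :
  map_mx (@complex.Re R) (complexify M *m v) = M *m map_mx (@complex.Re R) v /\
  map_mx (@complex.Im R) (complexify M *m v) = M *m map_mx (@complex.Im R) v.
Proof.
split; apply/matrixP => i j; rewrite !mxE raddf_sum; apply: eq_bigr => k _;
  rewrite !mxE; case: (v k j) => a b /=; by rewrite mul0r ?subr0 ?addr0.
Qed.

Lemma uncontrollable_vector_parts {R : realType} {n m : nat}
    {A0 : 'M[R]_n} {B : 'M[R]_(n, m)} {mu : R} {v : 'cV[R[i]]_n}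
    (a := map_mx (@complex.Re R) v) (b := map_mx (@complex.Im R) v) :
  uncontrollable_vector A0 B mu v ->
  [/\ A0^T *m a = - (mu *: b), A0^T *m b = mu *: a,
      B^T *m a = 0 & B^T *m b = 0].
Proof.
move=> [_ Av Bv].
have [<- <-] := complexify_mul_parts A0^T v.
have [<- <-] := complexify_mul_parts B^T v.
rewrite Av Bv; split; apply/matrixP => i j; rewrite !mxE //;
  by case: (v i j) => x y /=; rewrite mul0r ?sub0r ?add0r.
Qed.

(** Each diagonal entry of [P *m P^T] is the sum of squares of a row of [P], and a vanishing sum of
    real squares has only zero terms. *)
Lemma gram_eq0 {R : realType} {n k : nat} {P : 'M[R]_(n, k)} :
  P *m P^T = 0 -> P = 0.
Proof.
move=> PP0; apply/matrixP => i j; rewrite mxE.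
have /matrixP/(_ i i) := PP0; rewrite !mxE => /eqP.
rewrite psumr_eq0 => [/allP/(_ j (mem_index_enum _))|l _]; rewrite !mxE -expr2.
  by rewrite sqrf_eq0 => /eqP.
exact: sqr_ge0.
Qed.

(** With [X0 = a a^T + b b^T], the product [A0^T X0 = mu (a b^T - b a^T)] is skew-symmetric and
    [X0 A0] is its transpose, so the linear terms cancel. *)
Lemma outer_sum_solution {R : realType} {n m : nat}
    {A0 : 'M[R]_n} {B : 'M[R]_(n, m)} {mu t : R} {a b : 'cV[R]_n} :
  A0^T *m a = - (mu *: b) -> A0^T *m b = mu *: a ->
  B^T *m a = 0 -> B^T *m b = 0 ->
  riccati_solutions A0 B (t *: (a *m a^T + b *m b^T)).
Proof.
move=> Aa Ab Ba Bb; split.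
  by rewrite /symmetric_mx linearZ /= linearD /= !trmx_mul !trmxK.
have aA : a^T *m A0 = - (mu *: b^T).
  by rewrite -[A0]trmxK -trmx_mul Aa linearN linearZ.
have bA : b^T *m A0 = mu *: a^T.
  by rewrite -[A0]trmxK -trmx_mul Ab linearZ.
have BX : B^T *m (t *: (a *m a^T + b *m b^T)) = 0.
  by rewrite -scalemxAr mulmxDr !mulmxA Ba Bb !mul0mx addr0 scaler0.
(* The quadratic term contains the factor [B^T X], so it vanishes for every [t]; what remains is
   linear in [X]. *)
rewrite -[_ *m B *m _ *m _]mulmxA BX mulmx0 addr0.
rewrite mulNmx -scalemxAr -scalemxAl mulmxDr mulmxDl !mulmxA Aa Ab.
rewrite -!mulmxA aA bA !mulNmx !mulmxN -!scalemxAl -!scalemxAr.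
by rewrite -opprD -scalerDr addrA addrK addNr scaler0 oppr0.
Qed.

Theorem corollary4p1 (R : realType) (n m : nat)
    (A0 : 'M[R]_n) (B : 'M[R]_(n, m)) (mu : R)
    (mu_neq0 : mu != 0)
    (unc : uncontrollable_pair A0 B mu)
    (V : {vspace 'cV[R]_n})
    (hV : associated_subspace A0 B mu V)
    (L : 'M[R]_(n, 2))
    (hL : columns_basis V L) :
  [/\ infinite_set (riccati_solutions_on A0 B L),
      ~ bounded_set (riccati_solutions_on A0 B L)
    & ~ bounded_set (riccati_solutions A0 B)].
Proof.
have [v [uv VE]] := hV.
have [v_neq0 _ _] := uv.
have [Aa Ab Ba Bb] := uncontrollable_vector_parts uv.
set a := map_mx (@complex.Re R) v in VE Aa Ab Ba Bb.
set b := map_mx (@complex.Im R) v in VE Aa Ab Ba Bb.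
have [x ax] : exists x, a = L *m x.
  by apply: (basis_column_combination hL); rewrite VE memv_span ?inE ?eqxx.
have [y bY] : exists y, b = L *m y.
  by apply: (basis_column_combination hL);
    rewrite VE memv_span ?inE ?eqxx ?orbT.
set X0 := a *m a^T + b *m b^T.
have X0_neq0 : X0 != 0.
  apply: contra_neq v_neq0.
  (* [X0] is the Gram product [P P^T] of the block matrix [P = [a b]], so [X0 = 0] would kill both
     parts of [v]. *)
  rewrite /X0 -mul_row_col -tr_row_mx => /gram_eq0.
  rewrite -row_mx0 => /eq_row_mx[a0 b0].
  apply/matrixP => i j; rewrite mxE.
  have /matrixP/(_ i j) := a0; have /matrixP/(_ i j) := b0.
  by rewrite !mxE; case: (v i j) => re im /= -> ->.
have sol t : riccati_solutions A0 B (t *: X0)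
  by exact: (outer_sum_solution Aa Ab Ba Bb).
have sol_on t : riccati_solutions_on A0 B L (t *: X0).
  (* Substituting [a = L x] and [b = L y] in [X0] leaves [x x^T + y y^T] between [L] and [L^T]. *)
  split=> //; exists (t *: (x *m x^T + y *m y^T)).
    by rewrite /symmetric_mx linearZ /= linearD /= !trmx_mul !trmxK.
  rewrite -scalemxAr -scalemxAl mulmxDr mulmxDl /X0 ax bY.
  by rewrite !trmx_mul !mulmxA.
have unbounded := scale_line_unbounded X0_neq0.
split; [|exact: unbounded|exact: unbounded].
(* Infinitude is read off from unboundedness, since a finite set is bounded. *)
by move=> /finite_bounded; exact: unbounded.
Qed.
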